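(* Let $G$ be a finite non-abelian group all of whose proper subgroups are abelian, and suppose $|G|=p^\alpha$ for some prime $p$, where $\alpha>2$ is a positive integer. Then the nim-value of the achievement game on $G$ satisfies \[GEN(G)=\begin{cases} *0, & p=2,\\ *1 \text{ or } *2, & p\ne 2.\end{cases}\]
   Context: The achievement game $GEN(G)$ on a finite group $G$: two players alternately choose a not-yet-chosen element of $G$; the game ends as soon as the jointly chosen elements generate $G$, and the player who made the last move wins. A position is the set of jointly chosen elements; the starting position is $\emptyset$. The options $Opt(P)$ of a non-generating position $P$ are the sets $P\cup\{g\}$ with $g\in G\setminus P$; generating positions are terminal and have no options. The nim-value is defined recursively by $nim(P)=mex\{nim(Q): Q\in Opt(P)\}$, where $mex(A)$ is the smallest non-negative integer not in $A$ (so terminal positions have nim-value $0$). The nim-value of the game is $nim(\emptyset)$, and $GEN(G)=*k$ means that it equals $k$. *)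

(* Defs.v *)
From HB Require Import structures.
From mathcomp Require Import all_boot all_fingroup all_solvable.

Set Implicit Arguments.
Unset Strict Implicit.
Unset Printing Implicit Defensive.

Local Open Scope group_scope.

Lemma mex_exists (s : seq nat) : exists k, k \notin s.
Proof.
exists (\max_(x <- s) x).+1; apply/negP => max_s.
by have := @leq_bigmax_seq _ s xpredT id _ max_s isT; rewrite ltnn.
Qed.

Definition mex (s : seq nat) : nat := ex_minn (mex_exists s).

Section AchievementGame.

Variables (gT : finGroupType) (G : {group gT}).
Implicit Types P Q : {set gT}.

Definition options P : {set {set gT}} :=
  if <<P>> == G then set0 else [set g |: P | g in G :\: P].

(* The game from P lasts at most #|G :\: P| moves, so this much fuel is
   enough: nimE is the recursion nim(P) = mex {nim(Q) : Q in Opt(P)}. *)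
Fixpoint nim_rec (n : nat) P : nat :=
  if n is m.+1 then mex [seq nim_rec m Q | Q in options P] else 0%N.

Definition nim P : nat := nim_rec #|G :\: P| P.

Lemma card_option P Q : Q \in options P -> #|G :\: P| = #|G :\: Q|.+1.
Proof.
rewrite /options; case: ifP => _; first by rewrite inE.
case/imsetP=> g gGP ->; rewrite (cardsD1 g) gGP add1n; congr _.+1.
by apply: eq_card => x; rewrite !inE negb_or andbA.
Qed.

Lemma nimE P : nim P = mex [seq nim Q | Q in options P].
Proof.
rewrite /nim; case DP: #|G :\: P| => [|n] /=.
  rewrite (_ : image _ _ = [::]) ?/mex; first by case: ex_minnP => -[|k] // _ /(_ 0 isT).
  apply/eqP; rewrite -size_eq0 size_image; apply/pred0P => Q /=.
  by apply/negP => /card_option; rewrite DP.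
congr mex; apply/eq_in_map => Q; rewrite mem_enum => /card_option.
by rewrite DP => -[->].
Qed.

Definition GEN : nat := nim set0.

End AchievementGame.

(* Main.v *)
Require Import Defs.
From mathcomp Require Import all_boot all_fingroup all_solvable.

(** In a minimal non-abelian group two distinct maximal subgroups meet inside
    the center, because they are abelian and jointly generate the group.  So a
    non-generating position that is not central lies in exactly one maximal
    subgroup M: moves inside M keep it non-generating, all other moves end the
    game.  In a p-group the center and all these M have the parity of p, and
    by induction the nim-value of a non-generating position P depends only on
    whether P is central and whether #|P| has the parity of p:
      - P central:     0 if the parities agree, 2 otherwise;
      - P not central: 1 if the parities agree, 2 otherwise.
    The starting position is central of even size, so its value is 0 for p = 2
    and 2 for odd p. *)

Set Implicit Arguments.
Unset Strict Implicit.
Unset Printing Implicit Defensive.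

Lemma mexP (s : seq nat) k :
  (forall i, i < k -> i \in s) -> k \notin s -> mex s = k.
Proof.
move=> sub_s s'k; rewrite /mex; case: ex_minnP => m s'm min_m.
apply/eqP; rewrite eqn_leq min_m //= leqNgt.
by apply/negP => /sub_s m_s; rewrite m_s in s'm.
Qed.

Section Nim.

Local Open Scope group_scope.

Variables (gT : finGroupType) (G : {group gT}).
Implicit Type P : {set gT}.

Lemma nim_generating P : <<P>> = G -> nim G P = 0.
Proof.
move=> genP; rewrite nimE /options genP eqxx; apply: mexP => //.
by apply/imageP => -[Q]; rewrite inE.
Qed.

Lemma nim_unique P k :
    <<P>> != G ->
    (forall i, i < k -> exists2 x, x \in G :\: P & nim G (x |: P) = i) ->
    (forall x, x \in G :\: P -> nim G (x |: P) <> k) ->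
  nim G P = k.
Proof.
move=> ngP ex_i ne_k; rewrite nimE /options (negPf ngP); apply: mexP => [i ltik|].
  have [x Px <-] := ex_i i ltik.
  by apply: image_f; apply: imset_f.
by apply/imageP => -[_ /imsetP[x Px ->] /esym]; apply: ne_k.
Qed.

Hypothesis nonabG : ~~ abelian G.
Hypothesis abelian_proper : forall H : {group gT}, H \proper G -> abelian H.

Lemma maximal_cap_center (M N : {group gT}) :
  maximal M G -> maximal N G -> M != N -> M :&: N \subset 'Z(G).
Proof.
move=> maxM maxN neqMN; have sMG := maxgroupp maxM; have sNG := maxgroupp maxN.
have genMN : M <*> N = G.
  have sMNG : M <*> N \subset G by rewrite join_subG !proper_sub.
  apply/eqP; rewrite eqEproper sMNG; apply: contraNN neqMN => prMN.
  (* If the join were proper, maximality would identify it with both [M] and [N]. *)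
  have /maxgroupP[_ maxM'] := maxM; have /maxgroupP[_ maxN'] := maxN.
  have eM := maxM' (M <*> N)%G prMN (joing_subl _ _).
  have eN := maxN' (M <*> N)%G prMN (joing_subr _ _).
  by rewrite -val_eqE /= -[X in X == _]eM -[X in _ == X]eN.
(* Being abelian, [M] and [N] both centralize [M :&: N], hence so does their join. *)
rewrite subsetI subIset ?(proper_sub sMG) //= -genMN centY subsetI.
by rewrite (subset_trans (subsetIl _ _) (abelian_proper sMG))
           (subset_trans (subsetIr _ _) (abelian_proper sNG)).
Qed.

(** Central elements and a single [x] commute pairwise, so they generate an abelian group. *)
Lemma central_nongenerating x P :
  x \in G -> P \subset 'Z(G) -> <<x |: P>> != G.
Proof.
move=> Gx /subsetIP[sPG cGP]; apply: contraNneq nonabG => <-.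
have cPG y z : y \in P -> z \in G -> commute y z.
  by move=> /(subsetP cGP)/centP; apply.
rewrite abelian_gen; apply/centsP => y /setU1P[-> | Py] z /setU1P[-> | Pz] //.
- exact/commute_sym/cPG.
- exact: cPG.
- exact/cPG/(subsetP sPG).
Qed.

Lemma noncentral_sub_unique_maximal P :
    P \subset G -> ~~ (P \subset 'Z(G)) -> <<P>> != G ->
  exists2 M : {group gT}, maximal M G /\ P \subset M
    & forall x, x \in G -> (<<x |: P>> == G) = (x \notin M).
Proof.
move=> sPG ncP ngP.
have [|/eqP|[M maxM]] := @maximal_exists _ <<P>> G; rewrite ?gen_subG //.
  by rewrite (negPf ngP).
move=> sPM; exists M => // x Gx.
have prM := maxgroupp maxM; apply/idP/idP => [/eqP genxP | M'x].
  apply: contraL prM => Mx; rewrite properE negb_and negbK -{2}genxP.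
  by rewrite gen_subG subUset sub1set Mx sPM orbT.
have sxPG : x |: P \subset G by rewrite subUset sub1set Gx.
(* If [x |: P] does not generate, some maximal [N] contains it; since [P] is not central, [N] must
   be [M]. *)
have [|/eqP //|[N maxN]] := @maximal_exists _ <<x |: P>> G; rewrite ?gen_subG //.
rewrite subUset sub1set => /andP[Nx sPN].
case/negP: ncP; apply: subset_trans (maximal_cap_center maxM maxN _).
  by rewrite subsetI sPM.
by apply: contraNneq M'x => ->.
Qed.

Variable p : nat.
Hypothesis pG : p.-group G.

(** A nontrivial subgroup has order a positive power of [p]. The exponent 0 has to be excluded, as 1
    is odd even for [p = 2]. *)
Lemma odd_card_pgroup (H : {group gT}) :
  H \subset G -> H :!=: 1 -> odd #|H| = odd p.
Proof.
move=> sHG ntH; have [_ _ [n ->]] := pgroup_pdiv (pgroupS sHG pG) ntH.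
by rewrite oddX.
Qed.

Lemma nim_nongenerating P :
    P \subset G -> <<P>> != G ->
  nim G P = if odd #|P| == odd p then ~~ (P \subset 'Z(G)) : nat else 2.
Proof.
have [n] := ubnP #|G :\: P|; elim: n P => // n IHn P lePn sPG ngP.
(* A move flips the parity of the position, which swaps the two branches of the formula. *)
have IH x : x \in G :\: P -> <<x |: P>> != G ->
    nim G (x |: P) = if odd #|P| == odd p then 2
                     else ~~ (x |: P \subset 'Z(G)) : nat.
  move=> DPx ngxP; have /setDP[Gx P'x] := DPx.
  rewrite IHn ?subUset ?sub1set ?Gx //.
    by rewrite cardsU1 P'x /=; case: (odd _) (odd p) => [] [].
  move: lePn; rewrite ltnS (cardsD1 x) DPx; apply: leq_trans.
  by rewrite ltnS setDDl setUC.
have ex_out (H : {group gT}) : H \proper G -> P \subset H ->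
    exists2 x, x \in G :\: P & x \notin H.
  move=> /properP[_ [x Gx H'x]] sPH; exists x => //.
  by rewrite inE Gx (contra (subsetP sPH x)).
(* The parity mismatch rules out [P = H], so [H] still has an unchosen element. *)
have ex_in (H : {group gT}) : H \subset G -> H :!=: 1 -> P \subset H ->
    odd #|P| != odd p -> exists2 x, x \in G :\: P & x \in H.
  move=> sHG ntH sPH neq_odd; have /properP[_ [x Hx P'x]]: P \proper H.
    rewrite properEneq sPH andbT; apply: contraNneq neq_odd => ->.
    by rewrite odd_card_pgroup.
  by exists x; rewrite // inE P'x (subsetP sHG).
have [cP | ncP] /= := boolP (P \subset 'Z(G)).
  have ngxP x : x \in G :\: P -> <<x |: P>> != G.
    by case/setDP=> Gx _; apply: central_nongenerating.
  have cxP x : (x |: P \subset 'Z(G)) = (x \in 'Z(G)).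
    by rewrite subUset sub1set cP andbT.
  case: ifPn => eq_odd; apply: nim_unique => //.
  - by move=> x DPx; rewrite IH ?ngxP // eq_odd.
  - have prZ : 'Z(G) \proper G.
      rewrite properEneq center_sub andbT.
      by apply: contraNneq nonabG => {1}<-; apply: center_abelian.
    have ntZ : 'Z(G) != 1.
      rewrite (center_nil_eq1 (pgroup_nil pG)).
      by apply: contraNneq nonabG => ->; apply: abelian1.
    (* A move inside the center reaches value 0, a move outside it value 1. *)
    case=> [|[|//]] _.
    + have [x DPx Zx] := ex_in _ (center_sub G) ntZ cP eq_odd.
      by exists x; rewrite // IH ?ngxP // (negPf eq_odd) cxP Zx.
    + have [x DPx Z'x] := ex_out _ prZ cP.
      by exists x; rewrite // IH ?ngxP // (negPf eq_odd) cxP Z'x.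
  - move=> x DPx; rewrite IH ?ngxP // (negPf eq_odd).
    by case: (_ \subset _).
have [M [maxM sPM] genxP] := noncentral_sub_unique_maximal sPG ncP ngP.
have prM := maxgroupp maxM.
have ncxP x : x |: P \subset 'Z(G) = false.
  by rewrite subUset (negPf ncP) andbF.
(* Leaving [M] ends the game, so 0 is always among the options' values. *)
have nim0 : exists2 x, x \in G :\: P & nim G (x |: P) = 0.
  have [x DPx M'x] := ex_out _ prM sPM; exists x => //.
  by apply/nim_generating/eqP; rewrite genxP //; case/setDP: DPx.
case: ifPn => eq_odd; apply: nim_unique => //.
- by case.
- move=> x DPx; have [/eqP/nim_generating-> // | ngxP] := boolP (<<x |: P>> == G).
  by rewrite IH // eq_odd.
- case=> [|[|//]] _ //.
  (* The value 1 comes from a move inside [M], which is nontrivial because it contains the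
     noncentral [P]. *)
  have ntM : M :!=: 1.
    by apply: contraNneq ncP => M1; rewrite (subset_trans sPM) // M1 sub1G.
  have [x DPx Mx] := ex_in _ (proper_sub prM) ntM sPM eq_odd.
  exists x; rewrite // IH ?(negPf eq_odd) ?ncxP // genxP ?Mx //.
  by case/setDP: DPx.
- move=> x DPx; have [/eqP/nim_generating-> // | ngxP] := boolP (<<x |: P>> == G).
  by rewrite IH // (negPf eq_odd) ncxP.
Qed.

Lemma GEN_minimal_nonabelian_pgroup : GEN G = if odd p then 2 else 0.
Proof.
rewrite /GEN nim_nongenerating ?sub0set // ?cards0; first by case: (odd p).
by rewrite gen0; apply: contraNneq nonabG => <-; apply: abelian1.
Qed.

End Nim.

Theorem proposition4p8 (gT : finGroupType) (G : {group gT}) (p alpha : nat) :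
  ~~ abelian G ->
  (forall H : {group gT}, H \proper G -> abelian H) ->
  prime p ->
  2 < alpha ->
  #|G| = (p ^ alpha)%N ->
  (p = 2 -> GEN G = 0) /\ (p <> 2 -> GEN G = 1 \/ GEN G = 2).
Proof.
move=> nonabG abG p_pr _ oG.
have pG : (p.-group G)%g by rewrite /pgroup oG pnatX pnat_id.
rewrite (GEN_minimal_nonabelian_pgroup nonabG abG pG).
by split=> [-> // | /eqP p'2]; right; case: (even_prime p_pr) p'2 => ->.
Qed.
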